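(* There is an absolute constant $C$ such that every finite simple connected $3$-colorable graph $G$ of order $n$ with minimum degree $\delta(G)\ge 7$ satisfies $$\operatorname{diam}(G)\le \frac{17}{52}n+C .$$
   Context: All graphs are finite and simple. $\operatorname{diam}(G)$ is the maximum distance between two vertices of $G$; $3$-colorable means that the chromatic number satisfies $\chi(G)\le 3$. *)

(* Defs.v *)
From mathcomp Require Import all_boot.

Set Implicit Arguments.
Unset Strict Implicit.
Unset Printing Implicit Defensive.

Record sgraph := SGraph {
  vertex :> finType;
  adj : rel vertex;
  adj_sym : symmetric adj;
  adj_irrefl : irreflexive adj }.

Section GraphNotions.
Variable G : sgraph.

Definition connected : Prop :=
  0 < #|G| /\ forall x y : G, connect (@adj G) x y.

Definition degree (x : G) : nat := #|[set y | adj x y]|.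

(* Every degree is < #|G|, so the default value #|G| of the minimum only
   matters for the graph without vertices, which gets min_degree 0. *)
Definition min_degree : nat := \big[minn/#|G|]_(x : G) degree x.

Definition walk (x y : G) (k : nat) : bool :=
  [exists p : k.-tuple G, path (@adj G) x p && (last x p == y)].

(* A shortest walk has length < #|G|; the default value #|G| is only taken
   when x and y lie in different components (see walk_dist, dist_leq). *)
Definition dist (x y : G) : nat :=
  \big[minn/#|G|]_(k < #|G| | walk x y k) k.

Definition diam : nat := \max_(x : G) \max_(y : G) dist x y.

Definition colorable (k : nat) : bool :=
  [exists f : {ffun G -> 'I_k}, forall x, forall y, adj x y ==> (f x != f y)].

Lemma colorable_card : exists k, colorable k.
Proof.
exists #|G|; apply/existsP; exists [ffun x => enum_rank x].
apply/forallP=> x; apply/forallP=> y; apply/implyP; rewrite !ffunE.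
by apply: contraTneq => /enum_rank_inj ->; rewrite adj_irrefl.
Qed.

Definition chromatic_number : nat := ex_minn colorable_card.

Lemma dist_leq (x y : G) (k : nat) : k < #|G| -> walk x y k -> dist x y <= k.
Proof.
move=> ltk wk; rewrite /dist.
have: Ordinal ltk \in index_enum 'I_#|G| by rewrite mem_index_enum.
elim: (index_enum _) => // i s IHs; rewrite inE big_cons.
case/predU1P=> [<-|/IHs le_s] /=; first by rewrite wk geq_minl.
by case: ifP => // _; rewrite geq_min le_s orbT.
Qed.

Lemma walk_dist (x y : G) :
  connect (@adj G) x y -> (dist x y < #|G|) && walk x y (dist x y).
Proof.
case/connectP=> p0 /shortenP[p pth up _] ->.
set z := last x p.
have ltp : size p < #|G| by have := max_card (mem (x :: p)); rewrite (card_uniqP up).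
have wp : walk x z (size p) by apply/existsP; exists (in_tuple p); rewrite pth eqxx.
have lt_d : dist x z < #|G| := leq_ltn_trans (dist_leq ltp wp) ltp.
have: (dist x z == #|G|) || walk x z (dist x z).
  rewrite /dist; apply: (big_ind (fun d => (d == #|G|) || walk x z d)).
  - by rewrite eqxx.
  - by move=> a b Ha Hb; case: (leqP a b).
  - by move=> i ->; rewrite orbT.
by rewrite (ltn_eqF lt_d) lt_d.
Qed.

End GraphNotions.

(* Main.v *)
(** Split a connected graph into the distance layers of an endpoint of a
    diametral path, and record for each layer only how many vertices it has of
    each of the three colors.  The neighbors of a vertex of color [c] in a layer
    lie in this layer or in an adjacent one and have the other two colors, so
    whenever [c] occurs in a layer, the other colors occur at least 7 times in
    these three layers.  It remains to bound below the average layer size of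
    such sequences, a minimum mean cycle problem whose optimum is 52/17.  The
    dual certificate is a potential [p] of two consecutive layers such that
    [52 + p y z <= 17 |z| + p x y] for consecutive [x, y, z]; summing these
    inequalities along the sequence telescopes. *)
Require Import Defs.
From mathcomp Require Import all_boot all_order all_algebra reals.
From mathcomp Require Import zify.
Import GRing.Theory Num.Theory.

Local Open Scope nat_scope.

(** * Color counts of layers and their deficits *)

(* The numbers of vertices of each color in a distance layer. *)
Notation layer := (nat * nat * nat)%type.

Definition lsize (x : layer) := let: (a, b, c) := x in a + b + c.

Definition ncolors (x : layer) : nat :=
  let: (a, b, c) := x in (0 < a) + (0 < b) + (0 < c).

Definition served (x y z : layer) : bool :=
  let: (x1, x2, x3) := x in let: (y1, y2, y3) := y in
  let: (z1, z2, z3) := z in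
  [&& (0 < y1) ==> (7 <= (x2 + x3) + (y2 + y3) + (z2 + z3)),
      (0 < y2) ==> (7 <= (x1 + x3) + (y1 + y3) + (z1 + z3)) &
      (0 < y3) ==> (7 <= (x1 + x2) + (y1 + y2) + (z1 + z2))].

(* Summed over the colors [c] of [y], the number of vertices of colors other
   than [c] that the layer after [y] still has to provide. *)
Definition deficit (x y : layer) : nat :=
  let: (x1, x2, x3) := x in let: (y1, y2, y3) := y in
  (0 < y1) * (7 - (x2 + x3 + (y2 + y3))) +
  (0 < y2) * (7 - (x1 + x3 + (y1 + y3))) +
  (0 < y3) * (7 - (x1 + x2 + (y1 + y2))).

(* The largest deficit of [y] that [z] can make up, for any layer before [y]. *)
Definition max_deficit (y z : layer) : nat :=
  let: (y1, y2, y3) := y in let: (z1, z2, z3) := z in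
  (0 < y1) * minn (7 - (y2 + y3)) (z2 + z3) +
  (0 < y2) * minn (7 - (y1 + y3)) (z1 + z3) +
  (0 < y3) * minn (7 - (y1 + y2)) (z1 + z2).

(** For each color of [y], [served] makes the missing number at most what [z] has of the other
    colors. The bound is free of [x], so only pairs of layers need checking. *)
Lemma deficit_le_max x y z : served x y z -> deficit x y <= max_deficit y z.
Proof.
case: x => [[x1 x2] x3]; case: y => [[y1 y2] y3]; case: z => [[z1 z2] z3].
rewrite /served /deficit /max_deficit => /and3P[s1 s2 s3].
apply: leq_add; first apply: leq_add.
- by case: y1 s1 {s2 s3} => //= y1; lia.
- by case: y2 s2 {s1 s3} => //= y2; lia.
- by case: y3 s3 {s1 s2} => //= y3; lia.
Qed.

(** * The potential and its finite verification *)

(* Indexed by the number of colors of a layer, its size and its deficit, with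
   value 0 outside the lists.  The entries are the smallest natural numbers that
   are antitone in the deficit and satisfy [table_steps]; they were found by
   Bellman-Ford iteration. *)
Definition potential_table : seq (seq (seq nat)) :=
  [:: [::];
   [:: [::];
       [:: 35; 35; 28; 21; 14;  7];
       [:: 42; 42; 35; 25; 17; 17; 10];
       [:: 49; 49; 39; 30; 27; 20; 20;  3];
       [:: 56; 56; 53; 40; 40; 30; 20;  3];
       [:: 63; 63; 60; 50; 40; 30; 20;  3];
       [:: 70; 70; 60; 50; 40; 30; 20;  3];
       [:: 70; 70; 60; 50; 40; 30; 20;  3]];
   [:: [::]; [::];
       [:: 42; 42; 42; 35; 35; 25; 21; 14; 14;  7];
       [:: 49; 49; 49; 35; 35; 29; 28; 24; 24; 20; 10; 10];
       [:: 56; 56; 56; 43; 43; 36; 31; 30; 30; 30; 20];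
       [:: 63; 63; 63; 53; 53; 50; 40; 40; 37; 30];
       [:: 70; 70; 70; 60; 60; 50; 50; 40; 40];
       [:: 70; 70; 70; 60; 60; 50; 50; 40]];
   [:: [::]; [::]; [::];
       [:: 42; 42; 42; 35; 35; 25; 25; 17; 17; 17; 17; 10; 10;  3;  3];
       [:: 49; 49; 49; 39; 39; 30; 30; 27; 27; 20; 20; 20; 13;  3];
       [:: 56; 56; 56; 53; 53; 40; 40; 40; 40; 30; 30; 20];
       [:: 63; 63; 63; 60; 60; 50; 50; 40; 40; 30];
       [:: 70; 70; 70; 60; 60; 50; 50; 40]]].

Definition table_row (k t : nat) : seq nat := nth [::] (nth [::] potential_table k) t.

Definition table (y : layer) (s : nat) : nat :=
  nth 0 (table_row (ncolors y) (lsize y)) s.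

Lemma table_antitone y s s' : s <= s' -> table y s' <= table y s.
Proof.
move=> les; rewrite /table; set r := table_row _ _.
have sr : sorted geq r.
  have: all (all (sorted geq)) potential_table by vm_compute.
  move=> /(all_nthP [::]) H; rewrite /r /table_row.
  have [lk|/(nth_default [::])-> //] := ltnP (ncolors y) (size potential_table);
    last by rewrite nth_nil.
  have [lt|/(nth_default [::])-> //] :=
    ltnP (lsize y) (size (nth [::] potential_table (ncolors y))).
  by have /(all_nthP [::]) := H _ lk; apply.
(* Past the end of a row the default 0 is the least value. *)
have [lts|/(nth_default 0)-> //] := ltnP s' (size r).
have tr : transitive geq by move=> a b c ba cb; apply: leq_trans ba.
by apply: (sorted_leq_nth tr (fun n => leqnn n)) => //; rewrite inE (leq_ltn_trans les).
Qed.

Definition small_layers : seq layer :=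
  [seq y <- [seq (ab, c) | ab <- [seq (a, b) | a <- iota 0 8, b <- iota 0 8],
                           c <- iota 0 8]
     | 0 < lsize y < 8].

Lemma mem_small_layers y : 0 < lsize y < 8 -> y \in small_layers.
Proof.
case: y => [[a b] c] ys; rewrite mem_filter ys andTb.
have [la lb lc] : [/\ a < 8, b < 8 & c < 8] by move: ys => /=; split; lia.
apply/allpairsP; exists ((a, b), c); split; rewrite ?mem_iota //.
by apply/allpairsP; exists (a, b); rewrite !mem_iota la lb.
Qed.

Definition table_step (y z : layer) : bool :=
  52 + table z (deficit y z) <= 17 * lsize z + table y (max_deficit y z).

Lemma table_steps : all (fun y => all (table_step y) small_layers) small_layers.
Proof. by vm_compute. Qed.

(* 84 is the largest value that a layer of 8 vertices can afford:
   [52 + 84 = 17 * 8]. *)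
Definition potential (x y : layer) : nat :=
  if lsize y < 8 then table y (deficit x y) else 84.

(** The second bound serves a layer that follows one of at least 8 vertices, whose potential is 84:
    [32 = 84 - 52]. *)
Lemma table_le y s : 0 < lsize y < 8 -> table y s <= minn 84 (17 * lsize y + 32).
Proof.
move=> /mem_small_layers yS.
have: all (fun y => table y 0 <= minn 84 (17 * lsize y + 32)) small_layers by vm_compute.
by move/allP/(_ _ yS); apply/leq_trans/table_antitone.
Qed.

Lemma potential_le x y : 0 < lsize y -> potential x y <= 84.
Proof.
move=> y0; rewrite /potential; case: ltnP => // y8.
by have := table_le y (deficit x y); rewrite y0 y8 => /(_ isT); rewrite leq_min => /andP[].
Qed.

Lemma potential_step x y z : 0 < lsize y -> 0 < lsize z -> served x y z ->
  52 + potential y z <= 17 * lsize z + potential x y.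
Proof.
move=> y0 z0 xyz; rewrite {2}/potential.
have [z8|z8] := ltnP (lsize z) 8; last first.
  by rewrite /potential ltnNge z8 /=; lia.
have [y8|y8] := ltnP (lsize y) 8; last first.
  have := table_le z (deficit y z); rewrite z0 z8 /potential z8 => /(_ isT).
  by rewrite leq_min; lia.
have yS : y \in small_layers by rewrite mem_small_layers ?y0.
have zS : z \in small_layers by rewrite mem_small_layers ?z0.
have /allP/(_ _ yS)/allP/(_ _ zS) := table_steps.
(* Antitonicity trades [deficit x y] for [max_deficit y z], which removes [x]. *)
have := table_antitone y _ _ (deficit_le_max _ _ _ xyz).
by rewrite /table_step /potential z8; lia.
Qed.

(** * Distance layers of a graph *)

Section Graph.
Variables (G : sgraph) (f : G -> 'I_3) (o : G).
Hypothesis G_conn : connected G.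
Hypothesis f_col : forall x y : G, adj x y -> f x != f y.
Hypothesis deg7 : forall x : G, 7 <= degree x.

Lemma dist_adj (u v : G) : adj u v -> dist o v <= (dist o u).+1.
Proof.
move=> uv; have [_ con] := G_conn.
have /andP[ltv _] := walk_dist (con o v).
(* [dist_leq] only covers walks shorter than [#|G|]; a longer bound is trivial. *)
have [ltu|] := ltnP (dist o u).+1 #|G|; last exact: leq_trans (ltnW ltv).
apply: dist_leq => //.
have /andP[_ /existsP[p /andP[pp /eqP lp]]] := walk_dist (con o u).
by apply/existsP; exists [tuple of rcons p v]; rewrite rcons_path last_rcons pp lp uv eqxx.
Qed.

Lemma dist0 : dist o o = 0.
Proof.
apply/eqP; rewrite -leqn0; apply: dist_leq; first by case: G_conn.
by apply/existsP; exists [tuple]; rewrite /= eqxx.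
Qed.

(** Take the penultimate vertex of a shortest walk. *)
Lemma dist_pred (v : G) k : dist o v = k.+1 -> exists u : G, dist o u = k.
Proof.
move=> dv; have [_ con] := G_conn.
have /andP[ltv /existsP[p]] := walk_dist (con o v).
rewrite dv in ltv p *.
case: p => s /=; case/lastP: s => [//|s w].
rewrite size_rcons eqSS => /eqP ss; rewrite rcons_path last_rcons => /andP[/andP[ps aw] /eqP wv].
exists (last o s); apply/eqP; rewrite eqn_leq; apply/andP; split.
  apply: dist_leq; first exact: ltnW.
  by apply/existsP; exists (Tuple (introT eqP ss)); rewrite /= ps eqxx.
by rewrite -ltnS -dv -wv; apply: dist_adj.
Qed.

Lemma dist_onto (v : G) k : k <= dist o v -> exists u : G, dist o u = k.
Proof.
move En: (dist o v) => n; elim: n v En => [|n IHn] v dv.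
  by rewrite leqn0 => /eqP->; exists v.
rewrite leq_eqVlt => /predU1P[->|]; first by exists v.
by have [u du] := dist_pred _ _ dv; rewrite ltnS; apply: IHn du.
Qed.

Definition count_at (i : nat) (c : 'I_3) : nat :=
  \sum_(v | dist o v == i) (f v == c).

Definition c0 : 'I_3 := @Ordinal 3 0 isT.
Definition c1 : 'I_3 := @Ordinal 3 1 isT.
Definition c2 : 'I_3 := @Ordinal 3 2 isT.

Definition layer_at (i : nat) : layer := (count_at i c0, count_at i c1, count_at i c2).

Lemma lsize_layer_at i : lsize (layer_at i) = #|[pred v | dist o v == i]|.
Proof.
rewrite /= /count_at -!big_split -sum1_card /=; apply: eq_bigr => v _.
by case: (f v) => [[|[|[|]]]].
Qed.

Definition other_colors (i : nat) (c : 'I_3) : nat :=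
  \sum_(v | dist o v == i) (f v != c).

Lemma other_colorsE i :
  [/\ other_colors i c0 = count_at i c1 + count_at i c2,
      other_colors i c1 = count_at i c0 + count_at i c2 &
      other_colors i c2 = count_at i c0 + count_at i c1].
Proof.
by split; rewrite /count_at -big_split; apply: eq_bigr => v _;
  case: (f v) => [[|[|[|]]]].
Qed.

Lemma other_colors_ge7 i c : 0 < count_at i.+1 c ->
  7 <= other_colors i c + other_colors i.+1 c + other_colors i.+2 c.
Proof.
rewrite lt0n sum_nat_eq0 => /forall_inPn[v /eqP dv]; rewrite eqb0 negbK => /eqP fv.
apply: leq_trans (deg7 v) _.
(* Degree and counts become sums over all vertices, compared term by term. *)
rewrite /degree -sum1dep_card /other_colors !(big_mkcond (fun u => dist o u == _)).
rewrite -!big_split (big_mkcond (adj v)) /=; apply: leq_sum => u _.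
have [vu|//] := boolP (adj v u).
have := dist_adj _ _ vu; have uv : adj u v by rewrite adj_sym.
have := dist_adj _ _ uv.
rewrite dv -fv f_col // => l1 l2.
have: [|| dist o u == i, dist o u == i.+1 | dist o u == i.+2] by lia.
by case: (dist o u == i); case: (dist o u == i.+1); case: (dist o u == i.+2).
Qed.

Lemma served_layers i : served (layer_at i) (layer_at i.+1) (layer_at i.+2).
Proof.
have [e0 e1 e2] := other_colorsE i; have [e3 e4 e5] := other_colorsE i.+1.
have [e6 e7 e8] := other_colorsE i.+2.
apply/and3P; split; apply/implyP => /other_colors_ge7; lia.
Qed.

(** Each vertex lies in at most one layer; exchange the sums. *)
Lemma sum_lsize n : \sum_(0 <= i < n) lsize (layer_at i) <= #|G|.
Proof.
rewrite big_mkord; under eq_bigr => i _ do rewrite lsize_layer_at -sum1_card big_mkcond.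
rewrite exchange_big /= -sum1_card; apply: leq_sum => v _.
rewrite -big_mkcond /= sum1_card.
apply/card_le1_eqP => i j /eqP di /eqP dj.
by apply: val_inj; rewrite /= -di -dj.
Qed.

Lemma layers_bound (v : G) n : n < dist o v ->
  52 * n + potential (layer_at n) (layer_at n.+1)
    <= 17 * (\sum_(0 <= i < n.+2) lsize (layer_at i)) + 84.
Proof.
have ne k : k <= dist o v -> 0 < lsize (layer_at k).
  move=> /dist_onto[u du]; rewrite lsize_layer_at; apply/card_gt0P.
  by exists u; rewrite inE du.
elim: n => [|n IHn] nd; first by have := potential_le (layer_at 0) _ (ne _ nd); lia.
have -> : \sum_(0 <= i < n.+3) lsize (layer_at i) =
    \sum_(0 <= i < n.+2) lsize (layer_at i) + lsize (layer_at n.+2) by rewrite big_nat_recr.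
have := potential_step _ _ _ (ne _ (ltnW nd)) (ne _ nd) (served_layers n).
by have := IHn (ltnW nd); lia.
Qed.

Lemma dist_bound (v : G) : 52 * dist o v <= 17 * #|G| + 136.
Proof.
case dv: (dist o v) => [|n]; first by rewrite muln0.
(* The distance is [n.+1], so the constant is [84 + 52 = 136]. *)
have := layers_bound v n; rewrite dv => /(_ (leqnn _)).
by have := sum_lsize n.+2; lia.
Qed.

End Graph.

Lemma diam_bound (G : sgraph) : connected G -> chromatic_number G <= 3 ->
  7 <= min_degree G -> 52 * diam G <= 17 * #|G| + 136.
Proof.
move=> con; rewrite /chromatic_number; case: ex_minnP => k /existsP[f /forallP fc] _ k3 deg.
have f'c (x y : G) : adj x y -> widen_ord k3 (f x) != widen_ord k3 (f y).
  by move=> xy; have /forallP/(_ y)/implyP/(_ xy) := fc x.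
have deg' (x : G) : 7 <= degree x.
  apply: leq_trans deg _; rewrite /min_degree.
  have: x \in index_enum G by rewrite mem_index_enum.
  elim: (index_enum G) => // y s IH; rewrite inE big_cons.
  by case/predU1P => [<-|/IH]; rewrite geq_min ?leqnn // => ->; rewrite orbT.
rewrite /diam.
have [x ->] := eq_bigmax (fun x : G => \max_(y : G) dist x y) (proj1 con).
have [y ->] := eq_bigmax (dist x) (proj1 con).
exact: (dist_bound _ _ _ con f'c deg').
Qed.

Local Open Scope ring_scope.

Theorem proposition15 (R : realType) :
  exists C : R, forall G : sgraph,
    connected G ->
    (chromatic_number G <= 3)%N ->
    (7 <= min_degree G)%N ->
    (diam G)%:R <= 17%:R / 52%:R * #|G|%:R + C.
Proof.
exists (136%:R / 52%:R) => G con chi deg.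
rewrite mulrAC -mulrDl ler_pdivlMr ?ltr0n // -!natrM -natrD ler_nat mulnC.
exact: diam_bound.
Qed.
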